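(* Let $n\equiv 1\pmod 4$ be a positive integer. Then \[ \sum_{k=0}^{(n-1)/4}[8k+1]\frac{(q;q^4)_k^4}{(q^4;q^4)_k^4}q^{2k}\equiv \frac{(q^2;q^4)_{(n-1)/4}}{(q^4;q^4)_{(n-1)/4}}[n]\,q^{(1-n)/4}\pmod{[n]\Phi_n(q)^2}, \] and \[ \sum_{k=0}^{n-1}[8k+1]\frac{(q;q^4)_k^4}{(q^4;q^4)_k^4}q^{2k}\equiv \frac{(q^2;q^4)_{(n-1)/4}}{(q^4;q^4)_{(n-1)/4}}[n]\,q^{(1-n)/4}\pmod{[n]\Phi_n(q)^2}. \]
   Context: For an indeterminate $q$, $(a;q)_k=(1-a)(1-aq)\cdots(1-aq^{k-1})$ (with $(a;q)_0=1$) is the $q$-shifted factorial. For an integer $m$, $[m]=[m]_q=(1-q^m)/(1-q)$ is the $q$-integer. $\Phi_n(q)$ denotes the $n$-th cyclotomic polynomial in $q$. A congruence $A\equiv B\pmod{P(q)}$ between rational functions in $q$ means that $A-B$, written as a quotient of polynomials with denominator coprime to $P(q)$, has numerator divisible by $P(q)$. *)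

(* Defs.v *)
From HB Require Import structures.
From mathcomp Require Import all_boot all_order all_algebra all_field.
From mathcomp Require Import fraction.
Set Implicit Arguments. Unset Strict Implicit. Unset Printing Implicit Defensive.
Import Order.TTheory GRing.Theory Num.Theory.
Local Open Scope ring_scope.

Notation qpoly := {poly rat}.
Notation QF := {fraction {poly rat}}.

Definition toQF (p : qpoly) : QF := @FracField.tofrac _ p.

Definition qq : QF := toQF 'X.

Definition qpoch (a b : QF) (k : nat) : QF := \prod_(i < k) (1 - a * b ^+ i).

Definition qint (m : nat) : QF := (1 - qq ^+ m) / (1 - qq).

Definition qintP (m : nat) : qpoly := \sum_(i < m) 'X^i.

Definition PhiQ (n : nat) : qpoly := map_poly (intr : int -> rat) 'Phi_n.

Definition qcong (A B : QF) (P : qpoly) : Prop :=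
  exists N D : qpoly, [/\ coprimep D P, A - B = toQF N / toQF D & P %| N].

(* Main.v *)
(* Let m = (n - 1)/4 and c_k = (q;q^4)_k / (q^4;q^4)_k.

   Modulo Phi_d with d | n, d > 1: all c_k are regular at a primitive d-th root of unity z,
   and c_(ld+j) specializes to c_(ld) c_j for j < d.  If 0 <= s < d and d | 4s + 1 then
   c_(s-k) = z^(3k) c_s c_k, so the k-th and (s-k)-th summands cancel, while the summands
   with s < k < d vanish; as m = s mod d, both truncated sums vanish at z, and so does
   the right-hand side.

   Modulo Phi_n^3: replace one factor c_k^2 of the k-th summand by
     prod_(i < k) ((1 - q^(4i+1))^2 - t q^(4i+1)) / ((1 - q^(4i+4))^2 - t q^(4i+4)).
   At t = q^(-n) (1 - q^n)^2 the quadratic factors split and the sum is a terminating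
   6phi5, equal to the right-hand side; at t = 0 it is the sum to be evaluated.  Since t is
   divisible by Phi_n^2, only the first-order term in t matters, and it vanishes modulo
   Phi_n because the logarithmic derivative is symmetric under k -> m - k while the
   summands are antisymmetric.  The summands with m < k < n are divisible by Phi_n^4. *)
Require Import Defs.
From HB Require Import structures.
From mathcomp Require Import all_boot all_order all_algebra all_field.
From mathcomp Require Import fraction.
From mathcomp Require Import ring zify.
Set Implicit Arguments. Unset Strict Implicit. Unset Printing Implicit Defensive.
Import Order.TTheory GRing.Theory Num.Theory.
Local Open Scope ring_scope.

Lemma subr_neq0 (V : zmodType) (x y : V) : (x - y != 0) = (x != y).
Proof. by rewrite subr_eq0. Qed.

(** Discharges the side conditions of [field]: conjunctions of disequalities that agree with
    hypotheses only up to [ring]. *)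
Ltac nonzero :=
  repeat (apply/andP; split); try done;
  match goal with H : is_true (?x != 0) |- is_true (?y != 0) =>
    by rewrite (_ : y = x); [exact: H | ring] end.

(** * The terminating very-well-poised 6phi5 summation *)

Section SixPhiFive.
Variables (F : fieldType) (p a b c : F).

(** Quotient of consecutive summands of the 6phi5 with base p, parameters a, b, c, p^(-N) and
    argument a p^(N+1)/(bc). *)
Definition vwp_ratio (N i : nat) : F :=
  (1 - a * p ^+ i.+1 ^+ 2) / (1 - a * p ^+ i ^+ 2)
  * ((1 - a * p ^+ i) * (1 - b * p ^+ i) * (1 - c * p ^+ i)
     * (1 - p ^+ i / p ^+ N))
  / ((1 - p ^+ i.+1) * (1 - a * p ^+ i.+1 / b) * (1 - a * p ^+ i.+1 / c)
     * (1 - a * p ^+ i * p ^+ N.+1))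
  * (a * p ^+ N.+1 / (b * c)).

Definition vwp_term (N k : nat) : F := \prod_(i < k) vwp_ratio N i.

Definition vwp_boundary (N k : nat) : F :=
  vwp_term N k * (1 - a * p ^+ N.+1) * p ^+ N.+1 * (a / (b * c))
  * ((1 - a * p ^+ k) * (1 - b * p ^+ k) * (1 - c * p ^+ k))
  / ((1 - a * p ^+ k ^+ 2) * (1 - a * p ^+ N.+1 * p ^+ k)).

Hypotheses (p0 : p != 0) (b0 : b != 0) (c0 : c != 0).
Hypothesis p1 : forall i, p ^+ i.+1 != 1.
Hypothesis ap1 : forall i, a * p ^+ i != 1.
Hypothesis apb : forall i, a * p ^+ i.+1 != b.
Hypothesis apc : forall i, a * p ^+ i.+1 != c.

Let pX0 i : p ^+ i != 0. Proof. exact: expf_neq0. Qed.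

Let p_inj i j : (i < j)%N -> p ^+ i - p ^+ j != 0.
Proof.
move=> lt_ij; rewrite -(subnKC lt_ij) addSnnS exprD -{1}[p ^+ i]mulr1 -mulrBr.
by rewrite mulf_neq0 // subr_neq0 eq_sym p1.
Qed.

Let nz1 i : 1 - p ^+ i.+1 != 0. Proof. by rewrite subr_neq0 eq_sym. Qed.
Let nz2 i : 1 - a * p ^+ i ^+ 2 != 0.
Proof. by rewrite subr_neq0 eq_sym -exprM. Qed.
Let nz3 i : b - a * p ^+ i.+1 != 0. Proof. by rewrite subr_neq0 eq_sym. Qed.
Let nz4 i : c - a * p ^+ i.+1 != 0. Proof. by rewrite subr_neq0 eq_sym. Qed.
Let nz5 i j : 1 - a * p ^+ i * p ^+ j != 0.
Proof. by rewrite subr_neq0 eq_sym -mulrA -exprD. Qed.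

(** Passing from N to N+1 multiplies the i-th ratio by a factor that telescopes in i; k <= N keeps
    p^k - p^(N+1) nonzero. *)
Lemma vwp_termS N k : (k <= N)%N ->
  vwp_term N.+1 k = vwp_term N k
  * ((1 - p ^+ N.+1) * (1 - a * p ^+ N.+1) * p ^+ k
     / ((p ^+ k - p ^+ N.+1) * (1 - a * p ^+ N.+1 * p ^+ k))).
Proof.
elim: k => [|k IHk] le_kN.
  rewrite /vwp_term !big_ord0 expr0 mul1r !mulr1 divff //.
  rewrite mulf_neq0 //.
  by move: (nz5 0 N.+1); rewrite expr0 mulr1.
rewrite /vwp_term !big_ord_recr /= -!/(vwp_term _ _) IHk 1?ltnW //.
rewrite -!mulrA; congr (_ * _).
have := nz1 k; have := nz2 k; have := nz2 k.+1; have := nz3 k; have := nz4 k.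
have := nz5 k N.+1; have := nz5 k N.+2; have := nz5 k.+1 N.+1.
have := @p_inj k N.+1 (ltnW le_kN); have := @p_inj k.+1 N.+1 le_kN.
rewrite /vwp_ratio !(exprS p N.+1) !(exprS p k) (exprS p N).
have := p_inj le_kN.
have := pX0 N; have := pX0 k.
by move: (p ^+ N) (p ^+ k) => P y *; field; nonzero.
Qed.

(** Once [vwp_termS] removes N+1, each summand is the increment of [vwp_boundary] in K, a rational
    identity in p^N and p^K. *)
Lemma vwp_partial_sum N K : (K <= N)%N ->
  \sum_(k < K.+1) ((1 - a * p ^+ N.+1 / b) * (1 - a * p ^+ N.+1 / c)
                     * vwp_term N.+1 k
     - (1 - a * p ^+ N.+1) * (1 - a * p ^+ N.+1 / (b * c)) * vwp_term N k)
  = vwp_boundary N K.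
Proof.
elim: K => [_|K IHK le_KN].
  rewrite big_ord1 /vwp_boundary /vwp_term !big_ord0.
  have := nz2 0; have := nz5 N.+1 0; rewrite !expr0.
  by move: (p ^+ N.+1) => P *; field; nonzero.
rewrite big_ord_recr /= IHK 1?ltnW // vwp_termS // /vwp_boundary.
have -> : vwp_term N K.+1 = vwp_term N K * vwp_ratio N K.
  by rewrite /vwp_term big_ord_recr.
have := nz1 K; have := nz2 K; have := nz2 K.+1; have := nz3 K; have := nz4 K.
have := nz5 K N.+1; have := nz5 K.+1 N.+1.
have := @p_inj K.+1 N.+1 le_KN; have := p_inj le_KN.
rewrite /vwp_ratio !(exprS p N) !(exprS p K).
have := pX0 N; have := pX0 K; move: (vwp_term N K) => t.
by move: (p ^+ N) (p ^+ K) => P y *; field; nonzero.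
Qed.

(** This is [vwp_partial_sum] at K = N: the summand k = N+1 missing there, times the two factors on
    the left, equals [- vwp_boundary N N]. *)
Lemma vwp_sum_rec N :
  (1 - a * p ^+ N.+1 / b) * (1 - a * p ^+ N.+1 / c)
     * (\sum_(k < N.+2) vwp_term N.+1 k)
  = (1 - a * p ^+ N.+1) * (1 - a * p ^+ N.+1 / (b * c))
     * (\sum_(k < N.+1) vwp_term N k).
Proof.
have := vwp_partial_sum (leqnn N).
rewrite sumrB -!mulr_sumr => /eqP; rewrite subr_eq => /eqP partial.
rewrite [LHS]mulrC big_ord_recr /= mulrDl [X in X + _]mulrC partial.
rewrite [vwp_boundary N N + _]addrC -addrA -[RHS]addr0; congr (_ + _).
have -> : vwp_term N.+1 N.+1 = vwp_term N.+1 N * vwp_ratio N.+1 N.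
  by rewrite {1}/vwp_term big_ord_recr.
rewrite vwp_termS // /vwp_boundary.
have := nz1 N; have := nz2 N; have := nz2 N.+1; have := nz3 N; have := nz4 N.
have := nz5 N N.+1; have := nz5 N.+1 N.+1; have := nz5 N N.+2.
have := @p_inj N N.+1 (leqnn _).
rewrite /vwp_ratio !(exprS p N.+1) !(exprS p N).
have := pX0 N; move: (vwp_term N N) => t.
by move: (p ^+ N) => P *; field; nonzero.
Qed.

(* The terminating very-well-poised 6phi5 summation, proved by the q-WZ method:
   up to a shift and a factor, [vwp_boundary] is the WZ mate. *)
Lemma vwp_sum N :
  \sum_(k < N.+1) vwp_term N k
  = \prod_(i < N) ((1 - a * p ^+ i.+1) * (1 - a * p ^+ i.+1 / (b * c))
      / ((1 - a * p ^+ i.+1 / b) * (1 - a * p ^+ i.+1 / c))).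
Proof.
elim: N => [|N IHN]; first by rewrite big_ord1 big_ord0 /vwp_term big_ord0.
rewrite [RHS]big_ord_recr -IHN /=.
have := vwp_sum_rec N.
have := nz3 N; have := nz4 N.
move: (\sum_(k < N.+1) _) (\sum_(k < N.+2) _) (p ^+ N.+1) => S S' P n1 n2 rec.
have d1 : 1 - a * P / b != 0.
  by rewrite (_ : _ - _ = (b - a * P) / b) ?mulf_neq0 ?invr_eq0 //; field.
have d2 : 1 - a * P / c != 0.
  by rewrite (_ : _ - _ = (c - a * P) / c) ?mulf_neq0 ?invr_eq0 //; field.
apply: (mulfI (mulf_neq0 d1 d2)); rewrite rec mulrC.
by rewrite [in RHS]mulrCA [X in _ = _ * X]mulrC divfK // mulf_neq0.
Qed.
End SixPhiFive.

(** * The summands and their reversal at a root of unity *)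

Definition qratio (F : fieldType) (x : F) (k : nat) : F :=
  \prod_(i < k) ((1 - x ^+ (4 * i + 1)) / (1 - x ^+ (4 * i + 4))).

(** Defined over any field, so that one formula serves both the indeterminate [qq] and its
    specialization at a root of unity. *)
Definition qterm (F : fieldType) (x : F) (k : nat) : F :=
  (1 - x ^+ (8 * k + 1)) / (1 - x) * qratio x k ^+ 4 * x ^+ (2 * k).

(* Minus the logarithmic derivative at [t = 0] of
   prod_(i < k) ((1 - x^(4i+1))^2 - t x^(4i+1)) / ((1 - x^(4i+4))^2 - t x^(4i+4)). *)
Definition qlogder (F : fieldType) (x : F) (k : nat) : F :=
  \sum_(i < k) (x ^+ (4 * i + 1) / (1 - x ^+ (4 * i + 1)) ^+ 2
                - x ^+ (4 * i + 4) / (1 - x ^+ (4 * i + 4)) ^+ 2).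

Lemma sum_antisym (F : numFieldType) (f : nat -> F) s :
  (forall k, (k <= s)%N -> f (s - k)%N = - f k) -> \sum_(k < s.+1) f k = 0.
Proof.
move=> anti; suff: \sum_(k < s.+1) f k *+ 2 = 0.
  by rewrite sumrMnl => /eqP; rewrite mulrn_eq0 => /eqP.
rewrite sumrMnl mulr2n {1}(reindex_inj rev_ord_inj) /= -big_split /=.
by apply: big1 => k _; rewrite subSS anti ?addNr // -ltnS.
Qed.

Section RootOfUnity.
Variables (F : fieldType) (z : F) (s : nat).
Hypothesis zs : z ^+ (4 * s + 1) = 1.
Hypothesis z1 : forall i, (0 < i <= s)%N -> z ^+ (4 * i) != 1.

Let z0 : z != 0.
Proof.
apply: contra_eq_neq zs => ->; rewrite addn1 exprS mul0r eq_sym; exact: oner_neq0.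
Qed.

(** Since z^(4s+1) = 1, lowering s-k by one removes the factor (1 - z^(-(4k+4))) / (1 -
    z^(-(4k+1))), whose inverse is z^3 times the factor gained by c_(k+1). *)
Lemma qratio_rev k : (k <= s)%N ->
  qratio z (s - k) = z ^+ (3 * k) * qratio z s * qratio z k.
Proof.
elim: k => [_|k IHk lt_ks].
  by rewrite /qratio big_ord0 subn0 muln0 !mulr1 mul1r.
move: (IHk (ltnW lt_ks)).
have -> : (s - k = (s - k.+1).+1)%N by lia.
rewrite /qratio !big_ord_recr /= -!/(qratio _ _).
have -> : (4 * (s - k.+1) + 4 = 4 * (s - k))%N by lia.
have n1 : 1 - z ^+ (4 * (s - k)) != 0.
  by rewrite subr_neq0 eq_sym z1 //; lia.
have n2 : 1 - z ^+ (4 * k + 4) != 0.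
  by rewrite subr_neq0 eq_sym (_ : (4 * k + 4 = 4 * k.+1)%N) ?z1 //; lia.
have e1 : z ^+ (4 * (s - k)) = (z ^+ (4 * k + 1))^-1.
  apply: (@mulIf _ (z ^+ (4 * k + 1))); first exact: expf_neq0.
  by rewrite mulVf ?expf_neq0 // -exprD -zs; congr (_ ^+ _); lia.
have e2 : z ^+ (4 * (s - k.+1) + 1) = (z ^+ (4 * k + 4))^-1.
  apply: (@mulIf _ (z ^+ (4 * k + 4))); first exact: expf_neq0.
  by rewrite mulVf ?expf_neq0 // -exprD -zs; congr (_ ^+ _); lia.
rewrite {}e2; rewrite {}e1 in n1 *.
have y0 : z ^+ (4 * k) != 0 by exact: expf_neq0.
have -> : (3 * k.+1 = 3 * k + 3)%N by lia.
rewrite (exprD z (3 * k)).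
rewrite !(exprD z (4 * k)) expr1 in n1 n2 *.
move: (qratio z (s - k.+1)) (qratio z s) (qratio z k) (z ^+ (3 * k)) y0 n1 n2.
move: (z ^+ (4 * k)) => y A B C D y0 n1 n2 E.
have n3 : 1 - y * z != 0.
  apply: contra n1; rewrite !subr_eq0 => /eqP <-; rewrite invr1 //.
have n4 : 1 - (y * z ^+ 4)^-1 != 0.
  apply: contra n2; rewrite !subr_eq0 => /eqP E'.
  by rewrite -[y * _]invrK -E' invr1.
have n5 : y * z ^+ 4 - 1 != 0 by rewrite -opprB oppr_eq0.
have n6 : y * z - 1 != 0 by rewrite -opprB oppr_eq0.
(* Insert the removed factor and its inverse, so that [A] appears in the combination that [E]
   evaluates. *)
have -> : A = A * ((1 - (y * z ^+ 4)^-1) / (1 - (y * z)^-1))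
     * ((1 - (y * z)^-1) / (1 - (y * z ^+ 4)^-1)).
  by field; nonzero.
by rewrite E; field; nonzero.
Qed.

(** At k = s, [qratio_rev] reads 1 = z^(3s) c_s^2, so c_s^4 = z^(-6s). The sign comes from 1 -
    z^(8(s-k)+1) = -z^(-(8k+1)) (1 - z^(8k+1)), and the remaining powers of z combine to z^(2k). *)
Lemma qterm_rev k : (k <= s)%N -> qterm z (s - k) = - qterm z k.
Proof.
move=> le_ks; rewrite /qterm qratio_rev //.
have := qratio_rev (leqnn s); rewrite subnn [qratio z 0]big_ord0.
have : z ^+ k != 0 by exact: expf_neq0.
have : z ^+ (s - k) != 0 by exact: expf_neq0.
rewrite ![(_ * (s - k) + _)%N]addnC ![(_ * k + _)%N]addnC.
rewrite ![(_ * (s - k))%N]mulnC ![(_ * k)%N]mulnC !(exprM, exprD) !expr1.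
have := zs; rewrite addn1 exprSr mulnC exprM [z ^+ 3 ^+ s]exprAC.
have -> : z ^+ s = z ^+ k * z ^+ (s - k) by rewrite -exprD subnKC.
move: (qratio z s) (qratio z k) (z ^+ k) (z ^+ (s - k)) => C c e f H f0 e0 HC.
have HC4 : C ^+ 4 = ((e * f) ^+ 6)^-1.
  apply: (@mulIf _ ((e * f) ^+ 6)); first by rewrite expf_neq0 ?mulf_neq0.
  rewrite mulVf ?expf_neq0 ?mulf_neq0 // -[RHS](expr1n _ 2) HC; ring.
(* As e f = z^s and z^(4s+1) = 1, even z is a power of e f; the claim becomes a rational identity in
   e and f. *)
have Hz : z = ((e * f) ^+ 4)^-1.
  apply: (@mulfI _ ((e * f) ^+ 4)); first by rewrite expf_neq0 ?mulf_neq0.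
  by rewrite divff ?expf_neq0 ?mulf_neq0.
rewrite !exprMn HC4 ![_ / (1 - z) * _]mulrAC -[RHS]mulNr; congr (_ / _).
by rewrite Hz; field; nonzero.
Qed.

Lemma qlogder_rev k : (k <= s)%N -> qlogder z (s - k) = qlogder z k.
Proof.
pose h j := z ^+ (4 * j) / (1 - z ^+ (4 * j)) ^+ 2.
pose H k := \sum_(i < k) h i.+1.
(* The function u/(1-u)^2 is invariant under u -> 1/u, and z^(4j+1) is inverse to z^(4(s-j)); hence
   the numerator terms are values of [h] too, and the closed form is symmetric under j -> s - j. *)
suff closed j : (j <= s)%N -> qlogder z j = H s - H (s - j)%N - H j.
  by move=> le_ks; rewrite !closed ?leq_subr // subKn // addrAC.
elim: j => [_|j IHj lt_js].
  by rewrite /qlogder /H !big_ord0 subn0 subrr subr0.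
rewrite /qlogder /H big_ord_recr /= -/(qlogder z j) IHj 1?ltnW //.
rewrite /H [X in _ = _ - X]big_ord_recr /=.
have -> : (s - j = (s - j.+1).+1)%N by lia.
rewrite [X in _ - X - _]big_ord_recr /=.
have -> : (4 * j + 4 = 4 * j.+1)%N by lia.
rewrite -/(h j.+1).
have -> : z ^+ (4 * j + 1) / (1 - z ^+ (4 * j + 1)) ^+ 2 = h (s - j.+1).+1.
  rewrite /h.
  have := z1 (i := (s - j.+1).+1).
  have -> : z ^+ (4 * j + 1) = (z ^+ (4 * (s - j.+1).+1))^-1.
    apply: (@mulIf _ (z ^+ (4 * (s - j.+1).+1))); first exact: expf_neq0.
    by rewrite mulVf ?expf_neq0 // -exprD -zs; congr (_ ^+ _); lia.
  have : z ^+ (4 * (s - j.+1).+1) != 0 by exact: expf_neq0.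
  move: (z ^+ _) => y y0 y1; have {}y1 : 1 - y != 0.
    by rewrite subr_neq0 eq_sym y1 //; lia.
  have y2 : y - 1 != 0 by rewrite -opprB oppr_eq0.
  have y3 : 1 - y^-1 != 0.
    rewrite (_ : 1 - _ = (y - 1) / y) ?mulf_neq0 ?invr_eq0 //.
    by field.
  by field; nonzero.
ring.
Qed.
End RootOfUnity.

(** * Evaluation of rational functions at a complex number *)

Definition evalC (z : algC) (p : {poly rat}) : algC := (map_poly ratr p).[z].

Lemma evalC_is_monoid_morphism z : monoid_morphism (evalC z).
Proof.
split=> [|p r]; first by rewrite /evalC rmorph1 hornerC.
by rewrite /evalC rmorphM hornerM.
Qed.

Lemma evalC_is_zmod_morphism z : zmod_morphism (evalC z).
Proof. by move=> p r; rewrite /evalC rmorphB hornerD hornerN. Qed.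

HB.instance Definition _ z :=
  GRing.isZmodMorphism.Build {poly rat} algC (evalC z) (evalC_is_zmod_morphism z).
HB.instance Definition _ z :=
  GRing.isMonoidMorphism.Build {poly rat} algC (evalC z) (evalC_is_monoid_morphism z).

Lemma evalCX z : evalC z 'X = z.
Proof. by rewrite /evalC map_polyX hornerX. Qed.

Lemma toQF_eq0 p : (toQF p == 0) = (p == 0).
Proof. exact: tofrac_eq0. Qed.

Lemma toQFM p r : toQF (p * r) = toQF p * toQF r.
Proof. exact: tofracM. Qed.

Lemma toQFD p r : toQF (p + r) = toQF p + toQF r.
Proof. exact: tofracD. Qed.

Lemma toQFN p : toQF (- p) = - toQF p.
Proof. exact: tofracN. Qed.

Lemma toQF0 : toQF 0 = 0.
Proof. exact: tofrac0. Qed.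

Lemma toQF1 : toQF 1 = 1.
Proof. exact: tofrac1. Qed.

Lemma toQFX p k : toQF (p ^+ k) = toQF p ^+ k.
Proof. exact: tofracXn. Qed.

(** Evaluation is a relation because it makes sense only away from poles. For z a primitive n-th
    root of unity it is reduction modulo Phi_n on the local ring at Phi_n. *)
Definition has_value (z : algC) (x : QF) (v : algC) : Prop :=
  exists N D : {poly rat},
    [/\ evalC z D != 0, x = toQF N / toQF D & v = evalC z N / evalC z D].

Definition regular (z : algC) (x : QF) : Prop := exists v, has_value z x v.

Lemma toQF_neq0 z p : evalC z p != 0 -> toQF p != 0.
Proof. by rewrite toQF_eq0; apply: contra_neq => ->; rewrite rmorph0. Qed.

Section Value.
Variable z : algC.

Lemma has_value_poly p : has_value z (toQF p) (evalC z p).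
Proof.
by exists p, 1; rewrite toQF1 !rmorph1 !divr1; split; rewrite ?oner_neq0.
Qed.

Lemma has_valueX : has_value z qq z.
Proof. by have := has_value_poly 'X; rewrite evalCX. Qed.

Lemma has_value1 : has_value z 1 1.
Proof. by have := has_value_poly 1; rewrite rmorph1 toQF1. Qed.

Lemma has_value0 : has_value z 0 0.
Proof. by have := has_value_poly 0; rewrite rmorph0 toQF0. Qed.

Lemma has_valueD x y u v :
  has_value z x u -> has_value z y v -> has_value z (x + y) (u + v).
Proof.
move=> [N [D [D0 -> ->]]] [M [E [E0 -> ->]]]; exists (N * E + M * D), (D * E).
rewrite (addf_div _ _ (toQF_neq0 D0) (toQF_neq0 E0)).
rewrite toQFM toQFD !toQFM.
by split; rewrite ?rmorphM ?mulf_neq0 // rmorphD !rmorphM addf_div.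
Qed.

Lemma has_valueM x y u v :
  has_value z x u -> has_value z y v -> has_value z (x * y) (u * v).
Proof.
move=> [N [D [D0 -> ->]]] [M [E [E0 -> ->]]]; exists (N * M), (D * E).
by split; rewrite ?rmorphM ?mulf_neq0 // mulf_div ?toQFM.
Qed.

Lemma has_valueN x u : has_value z x u -> has_value z (- x) (- u).
Proof.
move=> [N [D [D0 -> ->]]]; exists (- N), D.
by rewrite -!mulNr rmorphN toQFN.
Qed.

Lemma has_valueB x y u v :
  has_value z x u -> has_value z y v -> has_value z (x - y) (u - v).
Proof. by move=> hx /has_valueN; apply: has_valueD. Qed.

Lemma has_valueV x u : u != 0 -> has_value z x u -> has_value z x^-1 u^-1.
Proof.
move=> u0 [N [D [D0 -> def_u]]]; exists D, N.
rewrite !invf_div def_u invf_div; split=> //; rewrite def_u in u0.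
by apply: contra_neq u0 => ->; rewrite mul0r.
Qed.

Lemma has_value_div x y u v : v != 0 ->
  has_value z x u -> has_value z y v -> has_value z (x / y) (u / v).
Proof. by move=> v0 hx hy; apply: has_valueM hx (has_valueV v0 hy). Qed.

Lemma has_valueXn x u k : has_value z x u -> has_value z (x ^+ k) (u ^+ k).
Proof.
move=> hx; elim: k => [|k IHk]; first exact: has_value1.
by rewrite !exprS; apply: has_valueM.
Qed.

Lemma has_value_sum (I : eqType) (r : seq I) (x : I -> QF) (u : I -> algC) :
  (forall i, i \in r -> has_value z (x i) (u i)) ->
  has_value z (\sum_(i <- r) x i) (\sum_(i <- r) u i).
Proof.
move=> h; rewrite !(big_seq_cond xpredT).
apply: (big_ind2 (has_value z)) => [||i]; first exact: has_value0.
  by move=> ? ? ? ?; apply: has_valueD.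
by rewrite andbT => /h.
Qed.

Lemma has_value_prod (I : eqType) (r : seq I) (x : I -> QF) (u : I -> algC) :
  (forall i, i \in r -> has_value z (x i) (u i)) ->
  has_value z (\prod_(i <- r) x i) (\prod_(i <- r) u i).
Proof.
move=> h; rewrite !(big_seq_cond xpredT).
apply: (big_ind2 (has_value z)) => [||i]; first exact: has_value1.
  by move=> ? ? ? ?; apply: has_valueM.
by rewrite andbT => /h.
Qed.

Lemma has_value_1subX k : has_value z (1 - qq ^+ k) (1 - z ^+ k).
Proof. exact: has_valueB has_value1 (has_valueXn k has_valueX). Qed.

Lemma has_value_regular x v : has_value z x v -> regular z x.
Proof. by exists v. Qed.

Lemma regularD x y : regular z x -> regular z y -> regular z (x + y).
Proof. by move=> [u hu] [v hv]; exists (u + v); apply: has_valueD. Qed.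

Lemma regularB x y : regular z x -> regular z y -> regular z (x - y).
Proof. by move=> [u hu] [v hv]; exists (u - v); apply: has_valueB. Qed.

Lemma regularM x y : regular z x -> regular z y -> regular z (x * y).
Proof. by move=> [u hu] [v hv]; exists (u * v); apply: has_valueM. Qed.

Lemma regularX x k : regular z x -> regular z (x ^+ k).
Proof. by move=> [u hu]; exists (u ^+ k); apply: has_valueXn. Qed.

Lemma regular_sum (I : eqType) (r : seq I) (x : I -> QF) :
  (forall i, i \in r -> regular z (x i)) -> regular z (\sum_(i <- r) x i).
Proof.
move=> h; rewrite big_seq_cond; apply: big_ind => [||i].
- exact: has_value_regular has_value0.
- exact: regularD.
- by rewrite andbT => /h.
Qed.

Lemma regular_prod (I : eqType) (r : seq I) (P : pred I) (x : I -> QF) :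
  (forall i, i \in r -> P i -> regular z (x i)) ->
  regular z (\prod_(i <- r | P i) x i).
Proof.
move=> h; rewrite big_seq_cond; apply: big_ind => [||i].
- exact: has_value_regular has_value1.
- exact: regularM.
- by case/andP => /h; apply.
Qed.

Lemma has_value0M x y : has_value z x 0 -> regular z y -> has_value z (x * y) 0.
Proof. by move=> hx [v hv]; rewrite -(mul0r v); apply: has_valueM. Qed.

End Value.

(** * Cyclotomic polynomials and congruences *)

Lemma map_PhiQ n (z : algC) : n.-primitive_root z ->
  map_poly ratr (PhiQ n) = cyclotomic z n.
Proof.
move=> prim_z; rewrite -(Cintr_Cyclotomic prim_z) /PhiQ -map_poly_comp.
by apply: eq_map_poly => i /=; apply: ratr_int.
Qed.

Lemma evalC_PhiQ_eq0 n z : (0 < n)%N -> (evalC z (PhiQ n) == 0) = n.-primitive_root z.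
Proof.
move=> n_gt0; have [w prim_w] := C_prim_root_exists n_gt0.
by rewrite /evalC (map_PhiQ prim_w) -(root_cyclotomic prim_w).
Qed.

(** Phi_n is the minimal polynomial of z over the rationals. *)
Lemma dvdp_PhiQ n z p : n.-primitive_root z -> (PhiQ n %| p) = (evalC z p == 0).
Proof.
move=> prim_z; have [P [defP _] rootP] := minCpolyP z.
rewrite -[evalC z p == 0]/(root _ z) rootP; congr (_ %| _).
apply: (map_inj_poly (fmorph_inj (ratr : rat -> algC)) (rmorph0 _)).
by rewrite -defP (minCpoly_cyclotomic prim_z) (map_PhiQ prim_z).
Qed.

Lemma coprimep_PhiQ n z p : n.-primitive_root z ->
  coprimep p (PhiQ n) = (evalC z p != 0).
Proof.
move=> prim_z; have n_gt0 := prim_order_gt0 prim_z.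
rewrite -(coprimep_map (ratr : {rmorphism rat -> algC})).
apply/idP/idP=> [cop | pz0].
  rewrite coprimep_sym in cop; apply: (coprimep_root cop).
  by rewrite -[root _ _]/(evalC z (PhiQ n) == 0) evalC_PhiQ_eq0.
apply: Pdiv.ClosedField.root_coprimep => x px0.
rewrite -[_.[x]]/(evalC x (PhiQ n)) evalC_PhiQ_eq0 //.
by apply: contra pz0 => prim_x; rewrite -(dvdp_PhiQ _ prim_z) (dvdp_PhiQ _ prim_x).
Qed.

Lemma coprimep_PhiQ2 a b : (0 < a)%N -> (0 < b)%N -> a != b ->
  coprimep (PhiQ a) (PhiQ b).
Proof.
move=> a_gt0 b_gt0 neq_ab; have [z prim_z] := C_prim_root_exists b_gt0.
rewrite (coprimep_PhiQ _ prim_z) evalC_PhiQ_eq0 //.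
apply: contra neq_ab => prim_az; rewrite eqn_dvd.
by rewrite (prim_order_dvd prim_az) (prim_order_dvd prim_z) !prim_expr_order ?eqxx.
Qed.

(** Turns vanishing at z into divisibility by Phi_n with a regular cofactor; products of such
    factors build up the higher powers of Phi_n. *)
Lemma has_value0_PhiQ n z x : n.-primitive_root z -> has_value z x 0 ->
  exists2 y, regular z y & x = toQF (PhiQ n) * y.
Proof.
move=> prim_z [N [D [D0 -> /esym/eqP]]].
rewrite mulf_eq0 invr_eq0 (negPf D0) orbF -(dvdp_PhiQ _ prim_z) => /dvdpP [M ->].
exists (toQF M / toQF D); last by rewrite toQFM mulrCA mulrA mulrC.
by exists (evalC z M / evalC z D), M, D.
Qed.

Lemma qcong_PhiQ_exp n z e A B x : n.-primitive_root z ->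
  regular z x -> A - B = toQF (PhiQ n) ^+ e * x -> qcong A B (PhiQ n ^+ e).
Proof.
move=> prim_z [v [N [D [D0 -> _]]]] defAB.
exists (PhiQ n ^+ e * N), D; rewrite dvdp_mulr ?dvdpp //; split=> //.
  by apply: coprimep_expr; rewrite (coprimep_PhiQ _ prim_z).
by rewrite defAB toQFM mulrA toQFX.
Qed.

Lemma qcong_PhiQ n z A B : n.-primitive_root z ->
  has_value z (A - B) 0 -> qcong A B (PhiQ n).
Proof.
move=> prim_z /(has_value0_PhiQ prim_z) [y reg_y defAB].
by rewrite -[PhiQ n]expr1; apply: (qcong_PhiQ_exp prim_z reg_y); rewrite expr1.
Qed.

Lemma qcong_eq0 A B P : A - B = 0 -> qcong A B P.
Proof.
move=> AB0; exists 0, 1; split; rewrite ?coprime1p ?dvdp0 //.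
by rewrite AB0 toQF0 mul0r.
Qed.

(** The two given fractions may have different denominators, each coprime to one modulus only. The
    lowest-terms denominator divides both, hence is coprime to P and Q, and the reduced numerator
    inherits both divisibilities. *)
Lemma qcong_mul_coprime A B P Q :
  coprimep P Q -> qcong A B P -> qcong A B Q -> qcong A B (P * Q).
Proof.
move=> copPQ [N1 [D1 [copP defP dvdP]]] [N2 [D2 [copQ defQ dvdQ]]].
(* A witness may have denominator 0, whose inverse is 0; a nonzero difference excludes this. *)
have [/qcong_eq0 // | AB0] := eqVneq (A - B) 0.
have D10 : D1 != 0.
  by apply: contra_neq AB0; rewrite defP => ->; rewrite toQF0 invr0 mulr0.
have D20 : D2 != 0.
  by apply: contra_neq AB0; rewrite defQ => ->; rewrite toQF0 invr0 mulr0.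
pose g := gcdp N1 D1; pose N := N1 %/ g; pose D := D1 %/ g.
have g0 : g != 0 by rewrite gcdp_eq0 (negPf D10) andbF.
have defN : N1 = N * g by rewrite divpK ?dvdp_gcdl.
have defD : D1 = D * g by rewrite divpK ?dvdp_gcdr.
have D0 : D != 0 by apply: contra_neq D10; rewrite defD => ->; rewrite mul0r.
have copND : coprimep D N by rewrite coprimep_sym coprimep_div_gcd // D10 orbT.
have defAB : A - B = toQF N / toQF D.
  by rewrite defP defN defD !toQFM -mulf_div divff ?mulr1 ?toQF_eq0.
have cross : N2 * D = N * D2.
  apply/eqP; rewrite -tofrac_eq -![FracField.tofrac _]/(toQF _) !toQFM.
  by rewrite -eqr_div ?toQF_eq0 // -defQ -defAB.
have dvdD : D %| D2.
  by rewrite -(Gauss_dvdpr _ copND) -cross dvdp_mull.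
have copDQ : coprimep D Q by apply: coprimep_dvdr copQ.
have copDP : coprimep D P by apply: coprimep_dvdr copP; rewrite defD dvdp_mulr.
have copgP : coprimep g P by apply: coprimep_dvdr copP; rewrite defD dvdp_mull.
exists N, D; split=> //; first by rewrite coprimepMr copDP.
rewrite Gauss_dvdp //; apply/andP; split.
  by rewrite -(@Gauss_dvdpl _ _ g) -?defN // coprimep_sym.
rewrite -(@Gauss_dvdpl _ _ D2) -?cross; first by rewrite dvdp_mulr.
by rewrite coprimep_sym.
Qed.

Lemma qcong_prod_PhiQ A B P (r : seq nat) : uniq r -> all (leq 1) r ->
  qcong A B P -> (forall d, d \in r -> coprimep P (PhiQ d)) ->
  (forall d, d \in r -> qcong A B (PhiQ d)) ->
  qcong A B (P * \prod_(d <- r) PhiQ d).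
Proof.
move=> + + congP; elim: r => [|d r IHr] /=; first by rewrite big_nil mulr1.
move=> /andP [notin uniq_r] /andP [d_gt0 r_gt0] cop cong.
rewrite big_cons mulrCA; apply: qcong_mul_coprime; last 1 first.
- by apply: IHr => // e er; [apply: cop | apply: cong]; rewrite inE er orbT.
- rewrite coprimepMr coprimep_sym cop ?mem_head //=.
  rewrite big_seq; apply: (big_ind (fun p => coprimep (PhiQ d) p)) => [|p p'|e er].
  + exact: coprimep1.
  + by rewrite coprimepMr => -> ->.
  + apply: coprimep_PhiQ2 => //; first exact: (allP r_gt0).
    by apply: contraNneq notin => ->.
- by apply: cong; rewrite mem_head.
Qed.

(** Cancel Phi_1 = X - 1 from the factorization of X^n - 1. *)
Lemma qintP_prod n : (0 < n)%N ->
  qintP n = \prod_(d <- divisors n | d != 1%N) PhiQ d.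
Proof.
move=> n_gt0; have Phi1 : PhiQ 1 = 'X - 1.
  have := prod_Cyclotomic (ltn0Sn 0); rewrite (_ : divisors 1 = [:: 1%N]) //.
  rewrite big_seq1 expr1 /PhiQ => ->.
  by rewrite rmorphB rmorph1 /= map_polyX.
have X1 : 'X - 1 != 0 :> {poly rat} by rewrite -polyC1 polyXsubC_eq0.
apply: (mulfI X1); rewrite -subrX1 -[in RHS]Phi1.
rewrite -(bigD1_seq 1%N) ?divisors_uniq -?dvdn_divisors ?dvd1n //=.
rewrite -(rmorph_prod (map_poly (intr : int -> rat))) prod_Cyclotomic //.
by rewrite rmorphB rmorph1 /= map_polyXn.
Qed.

(** Regroups the modulus into the pairwise coprime factors expected by [qcong_prod_PhiQ]. *)
Lemma qintP_mul_PhiQ_sqr n : (1 < n)%N ->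
  qintP n * PhiQ n ^+ 2 =
  PhiQ n ^+ 3 * \prod_(d <- [seq d <- divisors n | (d != 1%N) && (d != n)]) PhiQ d.
Proof.
move=> n_gt1; have n_gt0 := ltnW n_gt1.
rewrite qintP_prod // -big_filter (bigD1_seq n) ?filter_uniq ?divisors_uniq //=.
  by rewrite big_filter_cond big_filter mulrAC exprSr mulrC -exprSr.
by rewrite mem_filter -dvdn_divisors // dvdnn gtn_eqF.
Qed.

(** * Powers of q, and multiples of an odd d among the numbers 4i + r *)

Lemma qq1_neq0 k : 1 - qq ^+ k.+1 != 0.
Proof.
have -> : 1 - qq ^+ k.+1 = toQF (1 - 'X ^+ k.+1).
  by rewrite toQFD toQFN toQFX toQF1.
apply: (@toQF_neq0 0); rewrite rmorphB rmorphXn rmorph1 /= evalCX expr0n subr0.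
exact: oner_neq0.
Qed.

Lemma qq_neq0 : qq != 0.
Proof. by rewrite toQF_eq0 polyX_eq0. Qed.

Lemma exprn_sub_neq0 (F : fieldType) (q : F) i j :
  q != 0 -> (forall k, 1 - q ^+ k.+1 != 0) -> i != j -> q ^+ i - q ^+ j != 0.
Proof.
move=> q0 q1; have half a b : (a < b)%N -> q ^+ a - q ^+ b != 0.
  move=> lt_ab; rewrite -(subnKC lt_ab) addSnnS exprD -{1}[q ^+ a]mulr1 -mulrBr.
  by rewrite mulf_neq0 // expf_neq0.
by case: ltngtP => // /half // h _; rewrite -opprB oppr_eq0.
Qed.

Lemma has_value_neq0 z x v : has_value z x v -> v != 0 -> x != 0.
Proof.
move=> [N [D [D0 -> ->]]] nz; apply: mulf_neq0.
  by apply: (@toQF_neq0 z); apply: contra_neq nz => ->; rewrite mul0r.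
by rewrite invr_eq0; apply: toQF_neq0 D0.
Qed.

Lemma qpochE r k : qpoch (qq ^+ r) (qq ^+ 4) k = \prod_(i < k) (1 - qq ^+ (4 * i + r)).
Proof.
by apply: eq_bigr => i _; rewrite -exprM -exprD addnC.
Qed.

Lemma coprime_odd4 d : odd d -> coprime d 4.
Proof. by move=> odd_d; rewrite (coprimeXr 2 (n := 2)) // coprimen2. Qed.

Lemma exists_dvdn_4addr d e r : odd d ->
  exists i : 'I_d, (d %| 4 * (e + i) + r)%N.
Proof.
move=> odd_d; have d_gt0 : (0 < d)%N by case: d odd_d.
have cop := coprime_odd4 odd_d.
(* [y] represents -(4e + r) modulo d; the Chinese remainder theorem replaces it by a multiple of
   4. *)
pose y := ((4 * e + r) * d.-1)%N.
have /dvdnP [i def_i] : (4 %| chinese d 4 y 0)%N.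
  by rewrite /dvdn chinese_modr ?mod0n.
exists (Ordinal (ltn_pmod i d_gt0)) => /=.
rewrite mulnDr addnAC /dvdn -modnDmr modnMmr modnDmr mulnC in def_i *.
rewrite -def_i -modnDmr chinese_modl // modnDmr /y -mulnS prednK //.
by rewrite modnMl.
Qed.

Lemma dvdn_4addr_inj d e r i j : odd d -> (i < d)%N -> (j < d)%N ->
  (d %| 4 * (e + i) + r)%N -> (d %| 4 * (e + j) + r)%N -> i = j.
Proof.
move=> odd_d; have cop := coprime_odd4 odd_d.
wlog le_ij : i j / (i <= j)%N => [sym | _ lt_j dvdi].
  by move=> lti ltj di dj; case/orP: (leq_total i j) => /sym -> //.
have -> : (4 * (e + j) + r = 4 * (j - i) + (4 * (e + i) + r))%N by lia.
rewrite dvdn_addl // Gauss_dvdr // => /dvdnP [[|k]]; nia.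
Qed.

(** * Values of the summands at a primitive root of unity of odd order d *)

Section RootOfUnity.
Variables (d : nat) (z : algC).
Hypotheses (prim_z : d.-primitive_root z) (odd_d : odd d).

Let d_gt0 : (0 < d)%N. Proof. exact: prim_order_gt0 prim_z. Qed.

Lemma prim_root_4S_neq1 i : (i.+1 < d)%N -> 1 - z ^+ (4 * i + 4) != 0.
Proof.
move=> lt_id; rewrite subr_neq0 eq_sym -(prim_order_dvd prim_z).
rewrite (_ : (4 * i + 4 = 4 * i.+1)%N) 1?Gauss_dvdr ?coprime_odd4 //; last by lia.
by rewrite gtnNdvd.
Qed.

(** Cancelling 1 - q^d leaves geometric sums with values a and b at z, and b is nonzero in
    characteristic 0. *)
Lemma regular_div_1subX a b : (0 < b)%N ->
  regular z ((1 - qq ^+ (d * a)) / (1 - qq ^+ (d * b))).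
Proof.
move=> b_gt0.
have geo c : 1 - qq ^+ (d * c) = (1 - qq ^+ d) * \sum_(i < c) (qq ^+ d) ^+ i.
  by rewrite exprM -opprB subrX1 -mulNr opprB.
have val c : has_value z (\sum_(i < c) (qq ^+ d) ^+ i) c%:R.
  have -> : c%:R = \sum_(i < c) (z ^+ d) ^+ i :> algC.
    rewrite (prim_expr_order prim_z); under eq_bigr do rewrite expr1n.
    by rewrite sumr_const card_ord.
  by apply: has_value_sum => i _; apply/has_valueXn/has_valueXn/has_valueX.
rewrite !geo -mulf_div divff ?mul1r; last by case: d d_gt0 => // d' _; apply: qq1_neq0.
have b0 : b%:R != 0 :> algC by rewrite pnatr_eq0 -lt0n.
exact: has_value_regular (has_value_div b0 (val a) (val b)).
Qed.

(** Among d consecutive indices exactly one denominator vanishes at z, since 4 is invertible modulo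
    d. It is paired with a numerator whose exponent is also a multiple of d. *)
Lemma regular_window e r :
  regular z (\prod_(i < d) ((1 - qq ^+ (4 * (e + i) + r))
                            / (1 - qq ^+ (4 * (e + i) + 4)))).
Proof.
have [i0 /dvdnP [A defA]] := exists_dvdn_4addr e r odd_d.
have [j0 dvdj0] := exists_dvdn_4addr e 4 odd_d.
have /dvdnP [B defB] := dvdj0.
rewrite big_split /= prodfV (bigD1 i0) //= [X in _ / X](bigD1 j0) //= -mulf_div.
rewrite defA defB ![(_ * d)%N]mulnC; apply: regularM.
  by apply: regular_div_1subX; case: B defB dvdj0 => //; lia.
rewrite -prodfV; apply: regularM; apply: regular_prod => i _ neq_i.
  exact: has_value_regular (has_value_1subX _ _).
apply: has_value_regular; apply: has_valueV (has_value_1subX _ _).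
rewrite subr_neq0 eq_sym -(prim_order_dvd prim_z).
apply: contra neq_i => dvdi; apply/eqP/val_inj => /=.
exact: dvdn_4addr_inj odd_d (ltn_ord i) (ltn_ord j0) dvdi dvdj0.
Qed.
End RootOfUnity.

Section RootOfUnity.
Variables (d : nat) (z : algC).
Hypotheses (prim_z : d.-primitive_root z) (odd_d : odd d).

Let d_gt0 : (0 < d)%N. Proof. exact: prim_order_gt0 prim_z. Qed.

(** Windows of d factors are split off until fewer than d remain, where no denominator vanishes. The
    offset r is 1 in the summands and 2 on the right-hand side. *)
Lemma regular_ratio r k :
  regular z (\prod_(i < k) ((1 - qq ^+ (4 * i + r)) / (1 - qq ^+ (4 * i + 4)))).
Proof.
elim/ltn_ind: k => k IHk; have [lt_kd | le_dk] := ltnP k d.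
  apply: regular_prod => i _ _.
  apply: has_value_regular (has_value_div _ (has_value_1subX _ _) (has_value_1subX _ _)).
  by apply: (prim_root_4S_neq1 prim_z odd_d); apply: leq_ltn_trans lt_kd.
have -> : k = (k - d + d)%N by rewrite subnK.
rewrite big_split_ord /=; apply: regularM (regular_window prim_z odd_d _ _).
by apply: IHk; rewrite ltn_subrL d_gt0 (leq_trans d_gt0).
Qed.

Lemma has_value_qratio_block l j : (j < d)%N ->
  has_value z (\prod_(i < j) ((1 - qq ^+ (4 * (l * d + i) + 1))
                              / (1 - qq ^+ (4 * (l * d + i) + 4)))) (qratio z j).
Proof.
move=> lt_jd; apply: has_value_prod => i _.
have periodic c : z ^+ (4 * i + c) = z ^+ (4 * (l * d + i) + c).
  rewrite mulnDr -addnA [RHS]exprD mulnA [z ^+ (_ * d)]exprM.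
  by rewrite exprAC (prim_expr_order prim_z) expr1n mul1r.
rewrite !periodic; apply: has_value_div (has_value_1subX _ _) (has_value_1subX _ _).
rewrite -periodic; apply: (prim_root_4S_neq1 prim_z odd_d).
exact: leq_ltn_trans lt_jd.
Qed.

Lemma has_value_qratio j : (j < d)%N -> has_value z (qratio qq j) (qratio z j).
Proof. exact: (has_value_qratio_block 0). Qed.

Lemma regular_qratio k : regular z (qratio qq k).
Proof. exact: regular_ratio. Qed.

Lemma has_value_qint k : d != 1%N ->
  has_value z ((1 - qq ^+ k) / (1 - qq)) ((1 - z ^+ k) / (1 - z)).
Proof.
move=> d1; rewrite -(expr1 qq) -(expr1 z) -!exprM !mul1n.
apply: has_value_div (has_value_1subX _ _) (has_value_1subX _ _).
by rewrite subr_neq0 eq_sym -(prim_order_dvd prim_z) dvdn1.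
Qed.

(** The common constant is the fourth power of the value of c_(ld); everything else in the summand
    is periodic modulo d at z. *)
Lemma has_value_qterm_block l : d != 1%N ->
  exists v, forall j, (j < d)%N -> has_value z (qterm qq (l * d + j)) (v * qterm z j).
Proof.
move=> d1; have [v hv] := regular_qratio (l * d).
exists (v ^+ 4) => j lt_jd; rewrite /qterm.
have periodic a b c : z ^+ (a * (b * d + j) + c) = z ^+ (a * j + c).
  rewrite mulnDr -addnA [LHS]exprD mulnA [z ^+ (_ * d)]exprM.
  by rewrite exprAC (prim_expr_order prim_z) expr1n mul1r.
have -> : v ^+ 4 * ((1 - z ^+ (8 * j + 1)) / (1 - z) * qratio z j ^+ 4 * z ^+ (2 * j))
  = (1 - z ^+ (8 * j + 1)) / (1 - z) * (v * qratio z j) ^+ 4 * z ^+ (2 * j).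
  by rewrite exprMn; move: (_ / _) => t; ring.
apply: has_valueM; first apply: has_valueM.
- by rewrite -(periodic 8 l); apply: has_value_qint.
- apply: has_valueXn; rewrite /qratio big_split_ord /=.
  exact: has_valueM hv (has_value_qratio_block _ lt_jd).
- have := periodic 2 l 0; rewrite !addn0 => <-.
  exact: has_valueXn (has_valueX _).
Qed.

Section Root.
Variable s : nat.
Hypotheses (lt_sd : (s < d)%N) (dvd_s : (d %| 4 * s + 1)%N).

Lemma qterm_root_sum : \sum_(k < s.+1) qterm z k = 0.
Proof.
apply: sum_antisym => k; apply: qterm_rev => [|i /andP [i_gt0 le_is]].
  by apply/eqP; rewrite -(prim_order_dvd prim_z).
rewrite -subr_neq0 -opprB oppr_eq0.
case: i i_gt0 le_is => // i _ lt_is; rewrite mulnS addnC.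
by apply: (prim_root_4S_neq1 prim_z odd_d); apply: leq_ltn_trans lt_sd.
Qed.

Lemma qterm_root_eq0 k : (s < k)%N -> qterm z k = 0.
Proof.
move=> lt_sk; rewrite /qterm /qratio (bigD1 (Ordinal lt_sk)) //=.
have /eqP -> : z ^+ (4 * s + 1) == 1 by rewrite -(prim_order_dvd prim_z).
by rewrite subrr !mul0r expr0n mulr0 mul0r.
Qed.

Lemma qterm_root_period_sum : \sum_(k < d) qterm z k = 0.
Proof.
rewrite -(subnKC lt_sd) big_split_ord /= qterm_root_sum add0r.
by apply: big1 => i _; rewrite qterm_root_eq0 // addSn ltnS leq_addr.
Qed.

(** Full blocks vanish by [qterm_root_period_sum]; the last, possibly incomplete, block has length k
    = s+1 for the short sum and k = 0 for the long one. *)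
Lemma has_value_qterm_sum0 l k : d != 1%N -> (k <= d)%N ->
  \sum_(j < k) qterm z j = 0 -> has_value z (\sum_(j < l * d + k) qterm qq j) 0.
Proof.
move=> d1; elim: l k => [|l IHl] k le_kd sum0; rewrite big_split_ord /=;
  rewrite -[X in has_value z _ X]addr0;
  apply: has_valueD.
- by rewrite big_ord0; apply: has_value0.
- have [v hv] := has_value_qterm_block 0 d1.
  rewrite -(mulr0 v) -sum0 mulr_sumr; apply: has_value_sum => j _.
  exact/hv/leq_trans/le_kd.
- by rewrite mulSnr; apply: (IHl d) => //; apply: qterm_root_period_sum.
- have [v hv] := has_value_qterm_block l.+1 d1.
  rewrite -(mulr0 v) -sum0 mulr_sumr; apply: has_value_sum => j _.
  exact/hv/leq_trans/le_kd.
Qed.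
End Root.

Lemma has_value_qterm_sums n m : d != 1%N -> (d %| n)%N -> n = (4 * m + 1)%N ->
  has_value z (\sum_(j < m.+1) qterm qq j) 0
  /\ has_value z (\sum_(j < n) qterm qq j) 0.
Proof.
move=> d1 dvd_dn def_n.
have [s dvd_s] := exists_dvdn_4addr 0 1 odd_d; rewrite add0n in dvd_s.
have def_s : (m %% d)%N = s.
  apply: (dvdn_4addr_inj (e := 0) (r := 1) odd_d); rewrite ?ltn_pmod //.
  rewrite add0n /dvdn -modnDml modnMmr modnDml -/(dvdn _ _).
  by rewrite -def_n.
have sum_s := qterm_root_sum (ltn_ord s) dvd_s.
split.
  rewrite (divn_eq m d) def_s -addnS.
  exact: has_value_qterm_sum0 (ltn_ord s) dvd_s _ _ d1 (ltn_ord s) sum_s.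
have [l ->] := dvdnP dvd_dn; rewrite -[(l * d)%N]addn0.
by apply: (has_value_qterm_sum0 (ltn_ord s)); rewrite ?big_ord0.
Qed.

End RootOfUnity.

(** * Closed form of the perturbed sum *)

Definition qpert (F : fieldType) (x t : F) (k : nat) : F :=
  \prod_(i < k) (((1 - x ^+ (4 * i + 1)) ^+ 2 - t * x ^+ (4 * i + 1))
                 / ((1 - x ^+ (4 * i + 4)) ^+ 2 - t * x ^+ (4 * i + 4))).

Section ExactSum.
Variables (F : fieldType) (q : F) (m : nat).
Hypotheses (q0 : q != 0) (q1 : forall k, 1 - q ^+ k.+1 != 0).

Let Q := q ^+ (4 * m + 1).

Let q_inj i j : i != j -> q ^+ i - q ^+ j != 0.
Proof. exact: exprn_sub_neq0. Qed.

(** For t = (1-Q)^2/Q one has (1-u)^2 - t u = (1 - uQ)(1 - u/Q). The numerators become (Qq;q^4)_k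
    and (q^(-4m);q^4)_k, which gives the 6phi5 with base q^4, a = b = q, c = Qq, and argument
    q^2. *)
Lemma qpert_vwp_term k :
  (1 - q ^+ (8 * k + 1)) / (1 - q) * qratio q k ^+ 2 * q ^+ (2 * k)
    * qpert q (Q^-1 * (1 - Q) ^+ 2) k
  = vwp_term (q ^+ 4) q q (Q * q) m k.
Proof.
elim: k => [|k IHk].
  rewrite /qratio /qpert /vwp_term !big_ord0 muln0 add0n expr1 divff ?(q1 0) //.
  by rewrite expr1n !mulr1.
rewrite /vwp_term big_ord_recr /= -/(vwp_term _ _ _ _ _ _) -IHk.
rewrite /qratio /qpert !big_ord_recr /= -!/(qratio _ _) -!/(qpert _ _ _).
have := q1 0; have := q1 (8 * k); have := q1 (4 * k + 3).
have := q1 (4 * k + 4 * m + 4).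
have := @q_inj (4 * m) (4 * k + 3) ltac:(lia).
have -> : (8 * k.+1 + 1 = 8 * k + 9)%N by lia.
have -> : (2 * k.+1 = 2 * k + 2)%N by lia.
have e8 : q ^+ (8 * k) = (q ^+ 4 ^+ k) ^+ 2.
  by rewrite -!exprM; congr (_ ^+ _); lia.
rewrite /vwp_ratio !(exprS (q ^+ 4) k) (exprS (q ^+ 4) m).
rewrite (_ : (8 * k).+1 = 8 * k + 1)%N; last by lia.
rewrite (_ : (4 * k + 3).+1 = 4 * k + 4)%N; last by lia.
rewrite (_ : (4 * k + 4 * m + 4).+1 = 4 * k + (4 * m + 5))%N; last by lia.
rewrite /Q !(exprD q (8 * k)) !(exprD q (4 * k)) (exprD q (4 * m) 1).
rewrite (exprD q (4 * m)) (exprD q (2 * k) 2) e8 !(exprM q 4) !expr1.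
have y0 : q ^+ 4 ^+ k != 0 by rewrite !expf_neq0.
have P0 : q ^+ 4 ^+ m != 0 by rewrite !expf_neq0.
move: (qratio q k) (qpert _ _ k) (q ^+ (2 * k)) y0 P0 => c e x.
move: (q ^+ 4 ^+ k) (q ^+ 4 ^+ m) => y P y0 P0 n1 n2 n3 n4 n5.
(* This is P times the perturbed denominator at u = q^(4k+4), in factored form. *)
have n6 : (1 - y * (P * q ^+ 5)) * (P - y * q ^+ 3) != 0 by rewrite mulf_neq0.
by field; nonzero.
Qed.

(** Brings the product side of the 6phi5 to the shape of the right-hand side: 1 - q^(4i+5)
    telescopes against 1 - q^(4i+1), leaving [4N+1]. *)
Lemma telescope_qratio N :
  \prod_(i < N) ((1 - q ^+ (4 * i + 5)) / (1 - q ^+ (4 * i + 4)))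
  * \prod_(i < N) ((1 - q ^+ (4 * i + 2)) / (1 - q ^+ (4 * i + 1)) / q)
  = \prod_(i < N) ((1 - q ^+ (4 * i + 2)) / (1 - q ^+ (4 * i + 4)))
     * ((1 - q ^+ (4 * N + 1)) / (1 - q)) * q ^- N.
Proof.
elim: N => [|N IHN].
  by rewrite !big_ord0 muln0 add0n expr1 divff ?(q1 0) // invr1 !mulr1.
rewrite !big_ord_recr /= mulrACA IHN.
have -> : (4 * N.+1 + 1 = 4 * N + 5)%N by lia.
have qN : q ^+ N != 0 by rewrite expf_neq0.
have := q1 0; have := q1 (4 * N + 3); have := q1 (4 * N); rewrite -addnS addn1.
rewrite (exprS q N).
move: (\prod_(i < N) _) (1 - q ^+ (4 * N).+1) => X Y n1 n2 n3.
by field; nonzero.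
Qed.

Lemma qpert_sum :
  \sum_(k < m.+1) ((1 - q ^+ (8 * k + 1)) / (1 - q) * qratio q k ^+ 2 * q ^+ (2 * k)
    * qpert q (Q^-1 * (1 - Q) ^+ 2) k)
  = \prod_(i < m) ((1 - q ^+ (4 * i + 2)) / (1 - q ^+ (4 * i + 4)))
     * ((1 - Q) / (1 - q)) * q ^- m.
Proof.
under eq_bigr do rewrite qpert_vwp_term.
have q41 i j : q ^+ i * q ^+ 4 ^+ j = q ^+ (4 * j + i).
  by rewrite -exprM -exprD addnC.
have qq1 i j : (0 < i)%N -> q ^+ i * q ^+ 4 ^+ j != 1.
  move=> i_gt0; rewrite q41 -subr_neq0 -opprB oppr_eq0.
  by case: i i_gt0 => // i _; rewrite addnS q1.
rewrite vwp_sum ?mulf_neq0 ?(expf_neq0 _ q0) //; last 4 first.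
- by move=> i; rewrite -exprM mulnS -subr_neq0 -opprB oppr_eq0 q1.
- by move=> i; rewrite -{1}[q]expr1 qq1.
- by move=> i; rewrite mulrC -subr_neq0 -[X in _ - X]mul1r -mulrBl mulf_neq0 // -exprM
                      mulnS -opprB oppr_eq0 q1.
- move=> i; rewrite -{1}[q]expr1 q41 /Q -exprSr -subr_neq0 q_inj //; lia.
(* The factors containing Q have negative exponents -(4j+2) and -(4j+1) with j = m-1-i. Hence the
   reversal, and the factor 1/q in each ratio. *)
rewrite -telescope_qratio [X in _ = _ * X](reindex_inj rev_ord_inj) -big_split /=.
apply: eq_bigr => i _.
have -> : q * q ^+ 4 ^+ i.+1 = q ^+ (4 * i + 5).
  by rewrite -{1}[q]expr1 q41; congr (_ ^+ _); lia.
have -> : Q * q = q ^+ (4 * i + 4) * q ^+ (4 * (m - i.+1)) * q ^+ 2.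
  by rewrite /Q -exprSr -!exprD; congr (_ ^+ _); have := ltn_ord i; lia.
have : 1 - q ^+ (4 * (m - i.+1)) * q != 0 by rewrite -exprSr q1.
have : 1 - q ^+ (4 * i) * q ^+ 4 != 0 by rewrite -exprD addnS q1.
rewrite !(exprD q (4 * i)) !(exprD q (4 * (m - i.+1))) expr1.
have := expf_neq0 (4 * i) q0; have := expf_neq0 (4 * (m - i.+1)) q0.
move: (q ^+ (4 * (m - i.+1))) (q ^+ (4 * i)) => x y x0 y0 n1 n2.
have n3 : x * q - 1 != 0 by rewrite -opprB oppr_eq0.
by field; nonzero.
Qed.

End ExactSum.

(** * First-order expansion in t and the modulus Phi_n^3 *)

(** Follows from (1 - tA)/(1 - tB) = 1 - t(A-B) - t^2 B(A-B)/(1 - tB); the exact remainder replaces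
    a power series in t. *)
Lemma qpert_factor (F : fieldType) (a b t A B : F) :
  1 - a != 0 -> 1 - b != 0 -> (1 - b) ^+ 2 - t * b != 0 ->
  A = a / (1 - a) ^+ 2 -> B = b / (1 - b) ^+ 2 ->
  ((1 - a) ^+ 2 - t * a) / ((1 - b) ^+ 2 - t * b)
  = ((1 - a) / (1 - b)) ^+ 2
    * (1 - t * (A - B)
       + t ^+ 2 * (- B * (A - B) * ((1 - b) ^+ 2 / ((1 - b) ^+ 2 - t * b)))).
Proof. by move=> a1 b1 bt -> ->; field; nonzero. Qed.

Lemma second_order_mul (R : comNzRingType) (r s t u v w y : R) :
  r ^+ 2 * (1 - t * u + t ^+ 2 * w) * (s ^+ 2 * (1 - t * v + t ^+ 2 * y))
  = (r * s) ^+ 2 * (1 - t * (u + v)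
       + t ^+ 2 * (w + y + u * v - t * (u * y + w * v) + t ^+ 2 * (w * y))).
Proof. ring. Qed.

Section PrimitiveRoot.
Variables (m : nat) (z : algC).
Hypotheses (m_gt0 : (0 < m)%N) (prim_z : (4 * m + 1).-primitive_root z).

Let odd_n : odd (4 * m + 1). Proof. by rewrite addn1 /= oddM. Qed.

Lemma root_num_neq0 i : (i < m)%N -> 1 - z ^+ (4 * i + 1) != 0.
Proof.
move=> lt_im; rewrite subr_neq0 eq_sym -(prim_order_dvd prim_z).
by rewrite gtnNdvd //; lia.
Qed.

Lemma root_den_neq0 i : (i < m)%N -> 1 - z ^+ (4 * i + 4) != 0.
Proof. by move=> lt_im; apply: (prim_root_4S_neq1 prim_z odd_n); lia. Qed.

Lemma has_value_log_num r i : 1 - z ^+ (4 * i + r) != 0 ->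
  has_value z (qq ^+ (4 * i + r) / (1 - qq ^+ (4 * i + r)) ^+ 2)
              (z ^+ (4 * i + r) / (1 - z ^+ (4 * i + r)) ^+ 2).
Proof.
move=> nz; apply: has_value_div; first exact: expf_neq0.
  exact: has_valueXn (has_valueX z).
exact: has_valueXn (has_value_1subX _ _).
Qed.

Lemma has_value_qlogder k : (k <= m)%N ->
  has_value z (qlogder qq k) (qlogder z k).
Proof.
move=> le_km; apply: has_value_sum => i _.
have lt_im : (i < m)%N by apply: leq_trans le_km.
by apply: has_valueB; apply: has_value_log_num; rewrite ?root_num_neq0 ?root_den_neq0.
Qed.

(** As t vanishes at z, the perturbed denominators keep their nonzero values there, so the
    coefficient of t^2 stays regular. *)
Lemma qpert_expansion t k : has_value z t 0 -> (k <= m)%N ->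
  exists2 w, regular z w &
    qpert qq t k = qratio qq k ^+ 2 * (1 - t * qlogder qq k + t ^+ 2 * w).
Proof.
move=> t0; elim: k => [_|k IHk lt_km].
  exists 0; first exact: has_value_regular (has_value0 z).
  by rewrite /qpert /qratio /qlogder !big_ord0 !mulr0 subr0 addr0 mulr1 expr1n.
have [w reg_w expand_w] := IHk (ltnW lt_km).
rewrite /qpert /qratio /qlogder !big_ord_recr /= -!/(qpert _ _ _) -!/(qratio _ _).
rewrite -!/(qlogder _ _) expand_w.
have hu := has_value_qlogder (ltnW lt_km).
have ha := has_value_log_num (root_num_neq0 lt_km).
have hb := has_value_log_num (root_den_neq0 lt_km).
have hden : has_value z ((1 - qq ^+ (4 * k + 4)) ^+ 2 - t * qq ^+ (4 * k + 4))
                        ((1 - z ^+ (4 * k + 4)) ^+ 2).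
  have := has_valueB (has_valueXn 2 (has_value_1subX z (4 * k + 4)))
                     (has_valueM t0 (has_valueXn (4 * k + 4) (has_valueX z))).
  by rewrite mul0r subr0.
have den0 : (1 - z ^+ (4 * k + 4)) ^+ 2 != 0 by rewrite expf_neq0 ?root_den_neq0.
have na := has_value_neq0 (has_value_1subX z (4 * k + 1)) (root_num_neq0 lt_km).
have nb := has_value_neq0 (has_value_1subX z (4 * k + 4)) (root_den_neq0 lt_km).
rewrite (qpert_factor na nb (has_value_neq0 hden den0) (erefl _) (erefl _)).
rewrite second_order_mul; set y := (X in w + X).
have reg_t := has_value_regular t0.
have reg_u := has_value_regular hu.
have reg_v := has_value_regular (has_valueB ha hb).
have reg_y : regular z y.
  apply: regularM.
    by apply: regularM reg_v; apply: has_value_regular (has_valueN hb).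
  apply: has_value_regular (has_value_div den0 _ hden).
  exact: has_valueXn (has_value_1subX _ _).
eexists; last by reflexivity.
apply: regularD; first apply: regularB.
- by apply: regularD; [apply: regularD | apply: regularM].
- by apply: regularM => //; apply: regularD; apply: regularM.
- by apply: regularM; [apply: regularX | apply: regularM].
Qed.

Let n := (4 * m + 1)%N.

Lemma has_value_qterm k : (k < n)%N -> has_value z (qterm qq k) (qterm z k).
Proof.
move=> lt_kn; rewrite /qterm; apply: has_valueM; first apply: has_valueM.
- by apply: (has_value_qint prim_z); rewrite addn1 eqSS muln_eq0 -lt0n.
- by apply: has_valueXn; apply: (has_value_qratio prim_z odd_n).
- exact: has_valueXn (has_valueX z).
Qed.

Definition qrhs : QF :=
  \prod_(i < m) ((1 - qq ^+ (4 * i + 2)) / (1 - qq ^+ (4 * i + 4)))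
     * ((1 - qq ^+ n) / (1 - qq)) * qq ^- m.

Lemma qterm_sum_Phi3 : exists2 x, regular z x &
  \sum_(k < m.+1) qterm qq k - qrhs = toQF (PhiQ n) ^+ 3 * x.
Proof.
have h0 : has_value z (1 - qq ^+ n) 0.
  have := has_value_1subX z n; rewrite (prim_expr_order prim_z).
  by rewrite subrr.
have [g reg_g def_g] := has_value0_PhiQ prim_z h0.
have z0 : z != 0 by rewrite (prim_root_eq0 prim_z) addn1.
(* The value of t for which [qpert_sum] is exact. *)
pose t := (qq ^+ n)^-1 * (1 - qq ^+ n) ^+ 2.
have reg_qn : regular z (qq ^+ n)^-1.
  apply: has_value_regular (has_valueV (expf_neq0 n z0) _).
  exact: has_valueXn (has_valueX z).
have t0 : has_value z t 0.
  rewrite /t mulrC expr2 -mulrA; apply: (has_value0M h0).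
  by apply: (regularM _ reg_qn); apply: (has_value_regular h0).
have def_t : t = toQF (PhiQ n) ^+ 2 * ((qq ^+ n)^-1 * g ^+ 2).
  by rewrite /t def_g exprMn mulrCA.
have /fin_all_exists [w hw] : forall k : 'I_m.+1, exists w, regular z w /\
    qpert qq t k = qratio qq k ^+ 2 * (1 - t * qlogder qq k + t ^+ 2 * w).
  move=> k; have [w rw ew] := qpert_expansion t0 (ltnSE (ltn_ord k)).
  by exists w.
have sum0 : has_value z (\sum_(k < m.+1) qterm qq k * qlogder qq k) 0.
  have zs : z ^+ (4 * m + 1) = 1 by rewrite (prim_expr_order prim_z).
  have z1 i : (0 < i <= m)%N -> z ^+ (4 * i) != 1.
    rewrite -subr_neq0 -opprB oppr_eq0; case: i => // i lt_im.
    by rewrite mulnS addnC root_den_neq0.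
  rewrite -[X in has_value z _ X](@sum_antisym _ (fun k => qterm z k * qlogder z k) m).
    apply: has_value_sum => k _; apply: has_valueM.
      by apply: has_value_qterm; have := ltn_ord k; rewrite /n; lia.
    by apply: has_value_qlogder; rewrite -ltnS.
  by move=> k le_km; rewrite (qterm_rev zs z1) // (qlogder_rev zs z1) // mulNr.
have [v reg_v def_v] := has_value0_PhiQ prim_z sum0.
pose W := \sum_(k < m.+1) qterm qq k * w k.
have reg_W : regular z W.
  apply: regular_sum => k _; apply: regularM; last exact: (hw k).1.
  by apply: has_value_regular (has_value_qterm _); have := ltn_ord k; rewrite /n; lia.
(* The first product is divisible by Phi_n^2 from t and by Phi_n from [sum0]; the second by
   Phi_n^4. *)
have key : \sum_(k < m.+1) qterm qq k - qrhs
    = t * (\sum_(k < m.+1) qterm qq k * qlogder qq k) - t ^+ 2 * W.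
  rewrite /qrhs -(qpert_sum m qq_neq0 qq1_neq0) -/n -/t -sumrB.
  rewrite !mulr_sumr -sumrB; apply: eq_bigr => k _; rewrite (hw k).2 /qterm.
  move: (_ / _) (qratio qq k) (qq ^+ (2 * k)) (qlogder qq k) => A B C U.
  ring.
exists ((qq ^+ n)^-1 * g ^+ 2 * v
        - toQF (PhiQ n) * ((qq ^+ n)^-1 * g ^+ 2) ^+ 2 * W); last first.
  rewrite key def_v def_t.
  by move: (toQF (PhiQ _)) (_^-1) => P y; ring.
apply: regularB; apply: regularM => //.
  by apply: regularM => //; apply: regularX.
apply: regularM; first exact: has_value_regular (has_value_poly _ _).
by apply: regularX; apply: regularM => //; apply: regularX.
Qed.

(** For k > m the product c_k contains the numerator 1 - q^n, and for k < n no denominator vanishes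
    at z. Of the resulting Phi_n^4, one factor goes into the cofactor. *)
Lemma qterm_Phi4 k : (m < k < n)%N ->
  exists2 x, regular z x & qterm qq k = toQF (PhiQ n) ^+ 3 * x.
Proof.
case/andP=> lt_mk lt_kn.
have h0 : has_value z (qratio qq k) 0.
  have -> : 0 = qratio z k; last exact: (has_value_qratio prim_z odd_n).
  rewrite /qratio (bigD1 (Ordinal lt_mk)) //= (prim_expr_order prim_z).
  by rewrite subrr !mul0r.
have [g reg_g def_g] := has_value0_PhiQ prim_z h0.
exists ((1 - qq ^+ (8 * k + 1)) / (1 - qq)
        * (toQF (PhiQ n) * g ^+ 4) * qq ^+ (2 * k)); last first.
  rewrite /qterm def_g.
  by move: (_ / _) (toQF (PhiQ _)) (qq ^+ (2 * k)) => A P B; ring.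
apply: regularM; first apply: regularM.
- apply: has_value_regular (has_value_qint prim_z _ _).
  by rewrite addn1 eqSS muln_eq0 -lt0n.
- by apply: regularM; [apply: has_value_regular (has_value_poly _ _) | apply: regularX].
- exact: has_value_regular (has_valueXn _ (has_valueX z)).
Qed.
End PrimitiveRoot.

(** * Assembly of both congruences *)

Lemma qcong_from_roots n A B : (1 < n)%N ->
  qcong A B (PhiQ n ^+ 3) ->
  (forall d z, (1 < d)%N -> (d %| n)%N -> d.-primitive_root z ->
     has_value z (A - B) 0) ->
  qcong A B (qintP n * PhiQ n ^+ 2).
Proof.
move=> n_gt1 cong3 cong1; have n_gt0 := ltnW n_gt1.
have divisorP d : d \in [seq d <- divisors n | (d != 1%N) && (d != n)] ->
    [/\ (1 < d)%N, (d %| n)%N & d != n].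
  rewrite mem_filter -dvdn_divisors // => /andP [/andP [d1 dn] dvd_d].
  by split=> //; have := dvdn_gt0 n_gt0 dvd_d; case: d d1 {dn dvd_d} => [|[]].
rewrite qintP_mul_PhiQ_sqr //; apply: qcong_prod_PhiQ => //.
- by rewrite filter_uniq // divisors_uniq.
- by apply/allP => d /divisorP [/ltnW].
- move=> d /divisorP [/ltnW d_gt0 _ neq_dn]; apply: coprimep_expl.
  by apply: coprimep_PhiQ2; rewrite // eq_sym.
- move=> d /divisorP [d_gt1 dvd_d _].
  have [z prim_z] := C_prim_root_exists (ltnW d_gt1).
  exact: (qcong_PhiQ prim_z (cong1 d z d_gt1 dvd_d prim_z)).
Qed.

(** The factor [n] vanishes at z, and the remaining factors are regular there. *)
Lemma has_value_qrhs m d z : (1 < d)%N -> (d %| 4 * m + 1)%N ->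
  d.-primitive_root z -> has_value z (qrhs m) 0.
Proof.
move=> d_gt1 dvd_d prim_z.
have odd_d : odd d by apply: dvdn_odd dvd_d _; rewrite addn1 /= oddM.
rewrite /qrhs [_ * (_ / _)]mulrC -mulrA; apply: has_value0M.
  have := has_value_qint prim_z (4 * m + 1) (negbT (gtn_eqF d_gt1)).
  have /eqP -> : z ^+ (4 * m + 1) == 1 by rewrite -(prim_order_dvd prim_z).
  by rewrite subrr mul0r.
apply: regularM; first exact: (regular_ratio prim_z odd_d).
apply: has_value_regular (has_valueV _ (has_valueXn m (has_valueX z))).
by rewrite expf_neq0 // (prim_root_eq0 prim_z) -lt0n ltnW.
Qed.

Lemma qterm_tail_Phi3 m z : (0 < m)%N -> (4 * m + 1).-primitive_root z ->
  exists2 x, regular z x &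
    \sum_(k < 4 * m + 1) qterm qq k - \sum_(k < m.+1) qterm qq k
    = toQF (PhiQ (4 * m + 1)) ^+ 3 * x.
Proof.
move=> m_gt0 prim_z; have def_n : (4 * m + 1 = m.+1 + 3 * m)%N by lia.
have := fun k => @qterm_Phi4 m z m_gt0 prim_z k.
move: (toQF (PhiQ _)) => P tail; rewrite def_n big_split_ord /= addrAC subrr add0r.
apply: (big_ind (fun s => exists2 x, regular z x & s = P ^+ 3 * x)) => [||i _].
- by exists 0; [apply: has_value_regular (has_value0 z) | rewrite mulr0].
- by move=> s t [x rx ->] [y ry ->]; exists (x + y); [apply: regularD | rewrite mulrDr].
- by apply: tail; have := ltn_ord i; lia.
Qed.

Theorem theorem1 (n : nat) :
  (0 < n)%N -> (n %% 4 = 1)%N ->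
  let m := ((n - 1) %/ 4)%N in
  let rhs := qpoch (qq ^+ 2) (qq ^+ 4) m / qpoch (qq ^+ 4) (qq ^+ 4) m
             * qint n * qq ^- m in
  let term := fun k : nat =>
    qint (8 * k + 1) * (qpoch qq (qq ^+ 4) k ^+ 4 / qpoch (qq ^+ 4) (qq ^+ 4) k ^+ 4)
    * qq ^+ (2 * k) in
  qcong (\sum_(0 <= k < m.+1) term k) rhs (qintP n * PhiQ n ^+ 2) /\
  qcong (\sum_(0 <= k < n) term k) rhs (qintP n * PhiQ n ^+ 2).
Proof.
move=> _ n_mod4 m rhs term.
have def_n : n = (4 * m + 1)%N by rewrite /m; lia.
have termE k : term k = qterm qq k.
  rewrite /term /qterm -expr_div_n; congr (_ * _ ^+ 4 * _).
  by rewrite -{1}[qq]expr1 !qpochE /qratio big_split /= prodfV.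
have rhsE : rhs = qrhs m.
  by rewrite /rhs /qrhs -def_n !qpochE -prodfV -big_split.
have sumE N : \sum_(0 <= k < N) term k = \sum_(k < N) qterm qq k.
  by rewrite big_mkord; apply: eq_bigr => i _; apply: termE.
rewrite !sumE rhsE; clearbody m; clear rhs term termE sumE rhsE n_mod4; subst n.
have [m_eq0 | m_gt0] := posnP m.
  (* For n = 1 the modulus is (q-1)^2, outside the scope of the argument with roots of order d > 1;
     here both sides coincide. *)
  have sum1 : \sum_(i < 1) qterm qq i = qrhs 0.
    by rewrite big_ord1 /qterm /qrhs /qratio !big_ord0 expr1n !mulr1 mul1r invr1 mulr1.
  by split; apply: qcong_eq0; rewrite m_eq0 sum1 subrr.
have n_gt1 : (1 < 4 * m + 1)%N by lia.
have [z prim_z] := C_prim_root_exists (ltnW n_gt1).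
have [x reg_x def_x] := qterm_sum_Phi3 m_gt0 prim_z.
have roots d w : (1 < d)%N -> (d %| 4 * m + 1)%N -> d.-primitive_root w ->
    has_value w (\sum_(k < m.+1) qterm qq k - qrhs m) 0
    /\ has_value w (\sum_(k < 4 * m + 1) qterm qq k - qrhs m) 0.
  move=> d_gt1 dvd_d prim_w.
  have odd_d : odd d by apply: dvdn_odd dvd_d _; rewrite addn1 /= oddM.
  have [h1 h2] := has_value_qterm_sums prim_w odd_d (negbT (gtn_eqF d_gt1)) dvd_d erefl.
  have hr := has_value_qrhs d_gt1 dvd_d prim_w.
  by rewrite -(subr0 (0 : algC)); split; apply: has_valueB.
split; apply: qcong_from_roots => // [|d w d1 dn pw].
- exact: qcong_PhiQ_exp prim_z reg_x def_x.
- exact: (roots d w d1 dn pw).1.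
- have [y reg_y def_y] := qterm_tail_Phi3 m_gt0 prim_z.
  apply: (qcong_PhiQ_exp prim_z (regularD reg_x reg_y)).
  by rewrite mulrDr -def_x -def_y [RHS]addrC addrA subrK.
- exact: (roots d w d1 dn pw).2.
Qed.
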